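(* For $n\geq 1$, $$f_n(321,132,213)=f_n(123,312,231)=n!\sum_{k=1}^n\frac{1}{k!}\binom{n-1}{k-1}.$$
   Context: A forest on $[n]$ is an unordered rooted forest whose $n$ vertices are labeled bijectively by $[n]$. A forest avoids a pattern $\sigma$ if for every vertex $v$, the sequence of labels along the path from the root of the tree containing $v$ down to $v$ contains no subsequence in the same relative order as $\sigma$. $f_n(\sigma_1,\ldots,\sigma_m)$ is the number of forests on $[n]$ avoiding every $\sigma_i$. *)

(* Defs.v *)
From mathcomp Require Import all_boot all_order all_algebra.

Set Implicit Arguments.
Unset Strict Implicit.
Unset Printing Implicit Defensive.

(* A vertex is identified with its label, and the labels 1, ..., n are shifted
   to 0, ..., n - 1, which does not affect their relative order.  An unordered
   rooted forest is then determined by its parent map: p v = None when v is a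
   root, and p v = Some u when u is the parent of v. *)
Definition parent_map (n : nat) := {ffun 'I_n -> option 'I_n}.

(* A parent map describes a forest iff it has no cycle; since there are only
   n vertices, this says that climbing n times from any vertex exits through
   a root. *)
Definition is_forest (n : nat) (p : parent_map n) : bool :=
  [forall v : 'I_n, iter n (obind p) (Some v) == None].

Fixpoint climb (n : nat) (p : parent_map n) (fuel : nat) (v : 'I_n) :
    seq 'I_n :=
  if fuel is fuel'.+1 then
    v :: (if p v is Some u then climb p fuel' u else [::])
  else [::].

(* The labels read from the root down to v.  In a forest on n vertices this
   path has at most n vertices, so n units of fuel suffice. *)
Definition root_path (n : nat) (p : parent_map n) (v : 'I_n) : seq 'I_n :=
  rev (climb p n v).

Definition same_relative_order (s t : seq nat) : bool :=
  (size s == size t) &&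
  [forall i : 'I_(size s), forall j : 'I_(size s),
     (nth 0 s i < nth 0 s j) == (nth 0 t i < nth 0 t j)].

(* A pattern is written in one-line notation, e.g. [:: 1; 3; 2]. *)
Definition contains_pattern (n : nat) (s : seq 'I_n) (sigma : seq nat) : bool :=
  [exists t : (size sigma).-tuple 'I_n,
     subseq t s && same_relative_order (map val t) sigma].

Definition forest_avoids (n : nat) (p : parent_map n) (sigma : seq nat) : bool :=
  [forall v : 'I_n, ~~ contains_pattern (root_path p v) sigma].

Definition num_avoiding_forests (n : nat) (patterns : seq (seq nat)) : nat :=
  #|[set p : parent_map n | is_forest p && all (forest_avoids p) patterns]|.

(* Main.v *)
(* Avoiding the three rotations of 123 (or of 321) means that every path read
   from its root r is monotone for the cyclic order of the labels starting at
   r, i.e. each tree is an increasing tree for an order in which its root comes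
   first.  For a fixed assignment of vertices to roots, the number of such
   forests depends only on the block sizes, so the cyclic orders may be replaced
   by "root first, then the natural order".  For that order the forests with k
   given roots are counted by letting the other vertices choose, in increasing
   order, a parent among the roots and the smaller vertices: this gives
   k (k + 1) ... (n - 1) forests for each of the C(n, k) root sets. *)
Require Import Defs.
From mathcomp Require Import all_boot all_order all_algebra.
From mathcomp Require Import zify.
Set Implicit Arguments.
Unset Strict Implicit.
Unset Printing Implicit Defensive.

Import GRing.Theory Num.Theory.
Local Open Scope ring_scope.

(** * Products of ranks and independent choices of parents *)

(** Listed by increasing key, the elements of [A] have 0, 1, 2, ... predecessors. The induction
    removes the largest element, which changes no other rank. *)
Lemma prod_rank_in (T : finType) (key : T -> nat) (c : nat) (A : {set T}) :
  {in A &, injective key} ->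
  (\prod_(v in A) (c + #|[set u in A | key u < key v]|)
     = \prod_(i < #|A|) (c + i))%N.
Proof.
elim: {A}_.+1 {-2}A (ltnSn #|A|) => // m IH A ltAm inj_key.
have [->|[x Ax]] := set_0Vmem A; first by rewrite big_set0 cards0 big_ord0.
case: (@arg_maxnP T x (mem A) key Ax) => y yA max_y; have Ay : y \in A := yA.
have cardAy : #|A| = #|A :\ y|.+1 by rewrite (cardsD1 y) Ay.
have lt_y u : (u \in A -> (key u < key y) = (u != y))%N.
  move=> Au; rewrite ltn_neqAle [X in _ && X](max_y u Au) andbT.
  by congr (~~ _); apply/eqP/eqP => [/inj_key ->|->].
rewrite (big_setD1 y) //= cardAy big_ord_recr /= mulnC; congr (_ * _)%N; last first.
  congr (c + _)%N; apply: eq_card => u; rewrite !inE andbC.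
  by case Au: (u \in A); rewrite ?andbF // !andbT lt_y.
rewrite -IH; last first.
- by move=> u v /setD1P[_ Au] /setD1P[_ Av]; apply: inj_key.
- by rewrite -ltnS -cardAy.
apply: eq_bigr => v /setD1P[neq_vy Av]; congr (c + _)%N; apply: eq_card => u.
rewrite !inE; case: eqP => [->|//] /=.
by rewrite Ay /=; apply/negbTE; rewrite -leqNgt; apply: max_y.
Qed.

(** A condition imposed on each vertex separately cuts out a product of finite sets; vertices
    satisfying [rt] contribute a factor 1. *)
Lemma card_parent_choices (n : nat) (rt : pred 'I_n) (B : 'I_n -> {set 'I_n})
    (P : pred (parent_map n)) :
  (forall p, P p <-> forall v, if p v is Some u then ~~ rt v && (u \in B v)
                               else rt v) ->
  (\sum_(p | P p) 1 = \prod_(v | ~~ rt v) #|B v|)%N.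
Proof.
move=> PP; pose F v := if rt v then [set None] else [set Some u | u in B v].
have -> : (\sum_(p | P p) 1 = #|family (fun v => mem (F v))|)%N.
  rewrite sum1_card; apply: eq_card => p; apply/idP/familyP.
    move=> /PP Pp v; move: (Pp v); rewrite /F -topredE /=.
    case: (p v) => [u /andP[/negbTE -> Bu]|->]; last exact: set11.
    exact: imset_f.
  move=> Fp; apply/PP => v; move: (Fp v); rewrite /F -topredE /=.
  case: (rt v) => [/set1P -> //|/imsetP[u Bu ->]] //=.
rewrite card_family foldrE big_image /= [RHS]big_mkcond /=.
apply: eq_bigr => v _; rewrite /F; case: (rt v); first by rewrite cards1.
by rewrite card_imset //; move=> u w [].
Qed.

(** * Roots and upward paths in a forest *)

Definition tree_root (n : nat) (p : parent_map n) (v : 'I_n) : 'I_n :=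
  last v (climb p n v).

(** Induction from parent to child, grounded in the number of steps needed to climb out of the
    forest. *)
Lemma forest_ind (n : nat) (p : parent_map n) (P : 'I_n -> Prop) :
  is_forest p -> (forall v, (forall u, p v = Some u -> P u) -> P v) ->
  forall v, P v.
Proof.
move=> /forallP fp IH.
suff Pk k v : iter k (obind p) (Some v) = None -> P v.
  by move=> v; apply: Pk (eqP (fp v)).
elim: k v => // k IHk v; rewrite iterSr /= => itv.
by apply: IH => u pv; apply: IHk; rewrite -pv.
Qed.

Lemma climb_stable (n : nat) (p : parent_map n) (k m : nat) (v : 'I_n) :
  iter k (obind p) (Some v) = None -> (k <= m)%N -> climb p m v = climb p k v.
Proof.
elim: k m v => // k IH [//|m] v; rewrite iterSr /= => itv lekm.
by case pv: (p v) itv => [u|//] itv; rewrite IH.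
Qed.

(** The fuel is [n] on both sides: [n] steps already leave the forest, so one more unit changes
    nothing. *)
Lemma climbE (n : nat) (p : parent_map n) (v : 'I_n) : is_forest p ->
  climb p n v = v :: (if p v is Some u then climb p n u else [::]).
Proof.
move=> /forallP fp; have /= <- := @climb_stable n p n n.+1 v (eqP (fp v)) (leqnSn n).
by [].
Qed.

Lemma tree_rootE (n : nat) (p : parent_map n) (v : 'I_n) : is_forest p ->
  tree_root p v = if p v is Some u then tree_root p u else v.
Proof.
move=> fp; rewrite /tree_root climbE //=.
by case: (p v) => // u; rewrite climbE.
Qed.

Lemma tree_root_rootless (n : nat) (p : parent_map n) (v : 'I_n) :
  is_forest p -> p (tree_root p v) = None.
Proof.
move=> fp; move: v; apply: (forest_ind fp) => v IH; rewrite tree_rootE //.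
by case pv: (p v) => [u|//]; apply: IH.
Qed.

Lemma tree_root_idem (n : nat) (p : parent_map n) (v : 'I_n) :
  is_forest p -> tree_root p (tree_root p v) = tree_root p v.
Proof. by move=> fp; rewrite [LHS]tree_rootE // tree_root_rootless. Qed.

Lemma tree_root_eq (n : nat) (p : parent_map n) (v : 'I_n) :
  is_forest p -> (tree_root p v == v) = (p v == None).
Proof.
move=> fp; apply/eqP/eqP => [<-|pv]; first exact: tree_root_rootless.
by rewrite tree_rootE // pv.
Qed.

Lemma parent_neq (n : nat) (p : parent_map n) (v u : 'I_n) :
  is_forest p -> p v = Some u -> u != v.
Proof.
move=> fp; move: v u; apply: (forest_ind fp) => v IH u pv; apply: contraPneq pv => -> pv.
by have := IH v pv v pv; rewrite eqxx.
Qed.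

(* An arbitrary measure may be replaced by its rank, which is less than n. *)
Lemma forest_of_measure (n : nat) (p : parent_map n) (mu : 'I_n -> nat) :
  (forall v u, p v = Some u -> (mu u < mu v)%N) -> is_forest p.
Proof.
move=> mu_p; pose rk v := #|[set u : 'I_n | (mu u < mu v)%N]|.
have rk_p v u : p v = Some u -> (rk u < rk v)%N.
  move=> /mu_p lt_uv; apply/proper_card/properP; split.
    by apply/subsetP => w; rewrite !inE => /ltn_trans; apply.
  by exists u; rewrite !inE ?ltnn.
have rk_n v : (rk v < n)%N.
  rewrite -[X in (_ < X)%N]card_ord -cardsT; apply/proper_card/properP; split.
    exact: subsetT.
  by exists v; rewrite !inE ?ltnn.
apply/forallP => v; apply/eqP.
have: (forall k v, rk v < k -> iter k (obind p) (Some v) = None)%N; last exact.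
elim=> // k IH w lt_wk; rewrite iterSr /=.
case pw: (p w) => [u|]; first by apply: IH; have := rk_p _ _ pw; lia.
by elim: (k) => //= m ->.
Qed.

(** * Forests increasing for a family of orders *)

(** The order [key r] governs the tree rooted at [r], so it may differ from tree to tree. *)
Definition key_increasing (n : nat) (key : 'I_n -> 'I_n -> nat)
    (p : parent_map n) : bool :=
  [forall v, if p v is Some u
             then (key (tree_root p v) u < key (tree_root p v) v)%N else true].

Lemma key_increasingP (n : nat) (key : 'I_n -> 'I_n -> nat) (p : parent_map n) :
  reflect (forall v u, p v = Some u ->
             (key (tree_root p v) u < key (tree_root p v) v)%N)
          (key_increasing key p).
Proof.
apply: (iffP forallP) => [inc v u pv|inc v]; first by have := inc v; rewrite pv.
by case pv: (p v) => [u|//]; apply: inc.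
Qed.

(* The right-hand side does not depend on the key: the root of a block comes
   first, and the other vertices choose their parent among their
   predecessors, so only the size of the block matters. *)
Lemma card_key_increasing (n : nat) (key : 'I_n -> 'I_n -> nat) :
  (forall r, injective (key r)) ->
  (forall r v, v != r -> key r r < key r v)%N ->
  (\sum_(p : parent_map n | is_forest p && key_increasing key p) 1
   = \sum_(rho : {ffun 'I_n -> 'I_n} | [forall v, rho (rho v) == rho v])
       \prod_(r : 'I_n)
         \prod_(i < #|[set v | (rho v == r) && (rho v != v)]|) (1 + i))%N.
Proof.
move=> inj_key key_root.
rewrite (partition_big (fun p : parent_map n => [ffun v => tree_root p v])
           (fun rho : {ffun 'I_n -> 'I_n} => [forall v, rho (rho v) == rho v]));
  last first.
  by move=> p /andP[fp _]; apply/forallP => v; rewrite !ffunE tree_root_idem.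
apply: eq_bigr => rho /forallP rho_idem.
rewrite (@card_parent_choices n (fun v => rho v == v)
  (fun v => [set u | (rho u == rho v) && (key (rho v) u < key (rho v) v)%N])); last first.
  move=> p; split.
    move=> /andP[/andP[fp /key_increasingP inc] /eqP rhoE] v.
    rewrite -rhoE !ffunE tree_root_eq //.
    case pv: (p v) => [u|//]; rewrite !inE !ffunE inc // andbT.
    by rewrite [tree_root p v]tree_rootE // pv eqxx.
  move=> pB.
  have pB1 v u : p v = Some u -> rho u = rho v /\ (key (rho v) u < key (rho v) v)%N.
    by move=> pv; move: (pB v); rewrite pv inE => /and3P[_ /eqP -> ->].
  have fp : is_forest p.
    (* Since [rho] is constant along edges, consecutive measures are compared under one and the same
       key. *)
    apply: (@forest_of_measure _ _ (fun v => key (rho v) v)) => v u /pB1[-> //].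
  have rootE v : tree_root p v = rho v.
    move: v; apply: (forest_ind fp) => v IH; rewrite tree_rootE //.
    case pv: (p v) => [u|]; first by rewrite IH //; case: (pB1 _ _ pv).
    by move: (pB v); rewrite pv => /eqP.
  rewrite fp /=; apply/andP; split.
    by apply/key_increasingP => v u /pB1[_]; rewrite rootE.
  by apply/eqP/ffunP => v; rewrite ffunE rootE.
rewrite (partition_big rho predT) //=; apply: eq_bigr => r _.
set A := [set v | _].
rewrite -(@prod_rank_in _ (key r)); last by move=> u v _ _; apply: inj_key.
have AE v : (v \in A) = (rho v != v) && (rho v == r) by rewrite inE andbC.
rewrite (eq_bigl _ _ AE); apply: eq_bigr => v /andP[nrt /eqP rhov].
have rhor : rho r = r by rewrite -rhov; apply/eqP.
have vr : v != r by apply: contraNneq nrt => ->; rewrite rhor.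
(* The root [r] has the least key, so it is always a candidate parent: this is the summand 1. *)
rewrite rhov [LHS](cardsD1 r) !inE rhor eqxx key_root //=; congr (1 + _)%N.
apply: eq_card => u; rewrite !inE.
case: eqP => [->|/eqP ur] /=; first by rewrite rhor eqxx.
by case: eqP => //= ->; rewrite eq_sym ur.
Qed.

Definition root_first_key (n : nat) (r v : 'I_n) : nat :=
  if v == r then 0%N else v.+1.

(** For this key the condition becomes local to an edge and already excludes cycles. *)
Lemma root_first_increasing (n : nat) (p : parent_map n) :
  is_forest p && key_increasing (@root_first_key n) p
  = [forall v, if p v is Some u then (p u == None) || (u < v)%N else true].
Proof.
apply/andP/forallP => [[fp /key_increasingP inc] v|incp].
  case pv: (p v) => [u|//]; move: (inc _ _ pv); rewrite /root_first_key.
  case: (u =P tree_root p v) => [->|_]; first by rewrite tree_root_rootless.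
  by rewrite eq_sym tree_root_eq // pv /= ltnS orbC => ->.
have incP v u : p v = Some u -> p u = None \/ (u < v)%N.
  by move=> pv; move: (incp v); rewrite pv => /orP[/eqP|]; [left|right].
have fp : is_forest p.
  (* All roots get measure 0, since a root may carry a larger label than its children. *)
  apply: (@forest_of_measure _ _ (fun v => if p v == None then 0%N else v.+1)).
  by move=> v u pv; rewrite pv /=; case: (incP _ _ pv) => [->//|]; case: ifP.
split=> //; apply/key_increasingP => v u pv; rewrite /root_first_key.
rewrite [v == _]eq_sym tree_root_eq // pv /=.
have [pu|ltuv] := incP _ _ pv; last by case: ifP.
by rewrite tree_rootE // pv tree_rootE // pu eqxx.
Qed.

Lemma card_root_first_increasing (n : nat) :
  (\sum_(p : parent_map n | is_forest p && key_increasing (@root_first_key n) p) 1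
   = \sum_(k < n.+1) 'C(n, k) * \prod_(i < n - k) (k + i))%N.
Proof.
rewrite (eq_bigl _ _ (@root_first_increasing n)).
rewrite (partition_big (fun p : parent_map n => [set v | p v == None]) predT) //=.
transitivity (\sum_(S : {set 'I_n}) \prod_(i < n - #|S|) (#|S| + i))%N.
  apply: eq_bigr => S _.
  rewrite (@card_parent_choices n (mem S) (fun v => S :|: [set u : 'I_n | (u < v)%N])).
    have -> : (n - #|S|)%N = #|~: S| by rewrite [RHS]cardsCs setCK card_ord.
    rewrite -(@prod_rank_in _ val); last first.
      by move=> u v _ _; apply: val_inj.
    rewrite (eq_bigl (mem (~: S))) => [|v]; last by rewrite /= inE.
    (* The candidates split into the roots and the smaller non-roots; the latter give the rank of
       [v] in the complement of [S]. *)
    apply: eq_bigr => v _; rewrite -[LHS](cardsID S); congr (_ + _)%N.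
      by rewrite setUK.
    by apply: eq_card => u; rewrite !inE; case: (u \in S).
  move=> p; split.
    move=> /andP[/forallP incp /eqP SE] v; move: (incp v); rewrite -SE /= inE.
    by case: (p v) => [u|//] /=; rewrite !inE.
  move=> pS.
  have SE v : (v \in S) = (p v == None).
    by move: (pS v); case: (p v) => [u /andP[/negbTE]|].
  apply/andP; split; last by apply/eqP/setP => v; rewrite inE SE.
  by apply/forallP => v; move: (pS v); case: (p v) => // u /andP[_]; rewrite !inE SE.
rewrite (partition_big (fun S : {set 'I_n} => inord #|S| : 'I_n.+1) predT) //=.
apply: eq_bigr => k _.
have cardE (S : {set 'I_n}) : (inord #|S| == k) = (#|S| == k).
  by rewrite -val_eqE /= inordK // ltnS -[X in (_ <= X)%N]card_ord max_card.
rewrite (eq_bigl _ _ cardE) (eq_bigr (fun=> \prod_(i < n - k) (k + i)))%N.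
  by rewrite sum_nat_const -[X in 'C(X, _)]card_ord -card_draws cardsE.
by move=> S /eqP ->.
Qed.

(** * The closed formula *)

Lemma prod_shifted_fact (k m : nat) :
  (k`! * \prod_(i < m) (k.+1 + i) = (k + m)`!)%N.
Proof.
elim: m => [|m IH]; first by rewrite big_ord0 muln1 addn0.
by rewrite big_ord_recr /= mulnA IH addnS factS addSn mulnC.
Qed.

Lemma root_count_sum (n : nat) : (1 <= n)%N ->
  (\sum_(k < n.+1) 'C(n, k) * \prod_(i < n - k) (k + i))%N%:R
  = n`!%:R * \sum_(1 <= k < n.+1) k`!%:R^-1 * 'C(n.-1, k.-1)%:R :> rat.
Proof.
case: n => // n _.
(* The term k = 0 vanishes, because its product starts with the factor 0; the remaining index is k +
   1. *)
rewrite big_ord_recl subn0 big_ord_recl /= !mul0n muln0 add0n.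
rewrite natr_sum mulr_sumr big_add1 big_mkord; apply: eq_bigr => k _.
rewrite /= /bump /= add1n subSS.
have := prod_shifted_fact k (n - k); rewrite subnKC -1?ltnS //.
set X := (\prod_(i < _) _)%N => XE.
have fact_neq0 m : m`!%:R != 0 :> rat by rewrite pnatr_eq0 -lt0n fact_gt0.
apply: (mulfI (fact_neq0 k.+1)); rewrite mulrCA !mulrA mulfK //.
rewrite -!natrM; congr (_%:R).
have k_le : (k <= n)%N by rewrite -ltnS.
(* Multiplied by k! (n - k)!, both sides become (n + 1)! n!. *)
apply/eqP; rewrite -(eqn_pmul2r (fact_gt0 k)) -(eqn_pmul2r (fact_gt0 (n - k))).
have Bn := bin_fact k_le; have BSn : ('C(n.+1, k.+1) * (k.+1`! * (n - k)`!) = n.+1`!)%N.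
  by rewrite -subSS bin_fact.
apply/eqP; transitivity (n.+1`! * n`!)%N; last by rewrite -{1}Bn !mulnA.
by rewrite -XE -BSn; lia.
Qed.

(** * Patterns of length three along root paths *)

Lemma same_relative_order3 (a b c x y z : nat) :
  same_relative_order [:: a; b; c] [:: x; y; z]
  = [&& (a < b) == (x < y), (a < c) == (x < z), (b < a) == (y < x),
        (b < c) == (y < z), (c < a) == (z < x) & (c < b) == (z < y)]%N.
Proof.
rewrite /same_relative_order /=; apply/forallP/idP.
  move=> H; have H3 (i j : 'I_3) := forallP (H i) j.
  move: (H3 (inord 0) (inord 1)) (H3 (inord 0) (inord 2)) (H3 (inord 1) (inord 0))
        (H3 (inord 1) (inord 2)) (H3 (inord 2) (inord 0)) (H3 (inord 2) (inord 1)).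
  by rewrite !inordK //= => -> -> -> -> -> ->.
move=> /and5P[ab ac ba bc /andP[ca cb]] i; apply/forallP => j.
by case: i j => [[|[|[|//]]] ?] [[|[|[|//]]] ?]; rewrite /= ?ltnn.
Qed.

Lemma forest_avoids3P (n : nat) (p : parent_map n) (x y z : nat) :
  reflect (forall v a b c, subseq [:: a; b; c] (root_path p v) ->
             ~~ same_relative_order [:: val a; val b; val c] [:: x; y; z])
          (forest_avoids p [:: x; y; z]).
Proof.
apply: (iffP forallP) => [av v a b c abc|av v].
  apply: contra (av v) => sro; apply/existsP; exists [tuple a; b; c].
  by rewrite abc.
apply/existsPn => -[[|a [|b [|c [|? ?]]]] //= ?].
by apply/negP => /andP[/av /negP].
Qed.

(** Root, parent and child form the only triples whose avoidance is needed to make the key increase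
    along every edge. *)
Lemma subseq_climb_head (n : nat) (p : parent_map n) (v u : 'I_n) :
  is_forest p -> p v = Some u -> u != tree_root p v ->
  subseq [:: tree_root p v; u; v] (root_path p v).
Proof.
move=> fp pv ur; rewrite -subseq_rev /root_path revK climbE // pv [rev _]/=.
rewrite /= eqxx [climb _ _ _]climbE //= eqxx sub1seq.
move: ur; rewrite /tree_root climbE // pv climbE //=.
by case: (p u) => [w|] /=; [rewrite climbE //= mem_last | rewrite eqxx].
Qed.

Lemma climb_sorted (n : nat) (key : 'I_n -> 'I_n -> nat) (p : parent_map n) :
  is_forest p -> key_increasing key p -> forall v,
  sorted (fun u w => key (tree_root p v) w < key (tree_root p v) u)%N
         (climb p n v).
Proof.
move=> fp /key_increasingP inc; apply: (forest_ind fp) => v IH.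
have lt_key u := inc v u; rewrite tree_rootE // in lt_key *; rewrite climbE //.
case pv: (p v) lt_key => [u|//] lt_key.
by move: (IH _ pv); rewrite climbE //= lt_key.
Qed.

(** The hypothesis on [r], [u], [v] is applied to a root, a parent and its child. Conversely, any
    three vertices down a path have increasing keys by [climb_sorted], and the last hypothesis says
    that such triples match no pattern. *)
Lemma avoids_key_increasing (n : nat) (key : 'I_n -> 'I_n -> nat)
    (patterns : seq (seq nat)) (p : parent_map n) :
  all (fun s => size s == 3) patterns ->
  (forall r v, v != r -> key r r < key r v)%N ->
  (forall r u v : 'I_n, r != u -> r != v -> u != v ->
     ~~ has (same_relative_order [:: val r; val u; val v]) patterns ->
     key r u < key r v)%N ->
  (forall r a b c : 'I_n, (key r a < key r b < key r c)%N ->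
     ~~ has (same_relative_order [:: val a; val b; val c]) patterns) ->
  is_forest p && all (forest_avoids p) patterns
  = is_forest p && key_increasing key p.
Proof.
move=> /allP size3 key_root key_lt sro_key.
have [fp|//] := boolP (is_forest p); apply/allP/idP => [av|inc s s_in].
  apply/key_increasingP => v u pv; set r := tree_root p v.
  have rv : r != v by rewrite tree_root_eq // pv.
  have [ur|ur] := eqVneq u r; first by rewrite ur key_root // eq_sym.
  apply: key_lt; rewrite // 1?eq_sym //; first by rewrite eq_sym (parent_neq fp).
  apply/hasPn => s s_in; move: (size3 _ s_in) (av _ s_in).
  case: s s_in => [|x [|y [|z [|//]]]] // _ _ /forest_avoids3P; apply.
  exact: subseq_climb_head.
move: (size3 _ s_in); case: s s_in => [|x [|y [|z [|//]]]] // s_in _.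
apply/forest_avoids3P => v a b c abc.
suff /sro_key/hasPn : (key (tree_root p v) a < key (tree_root p v) b
                        < key (tree_root p v) c)%N by apply.
move: abc; rewrite -subseq_rev revK => /subseq_sorted.
move=> /(_ _ _ (climb_sorted fp inc v)) /=; rewrite andbT andbC; apply.
by move=> x1 y1 z1 h1 h2; apply: ltn_trans h2 h1.
Qed.

(* The patterns 123, 312, 231 are the rotations of 123, so a path starting at r
   avoids them iff it decreases cyclically: its labels occur in the order
   r, r - 1, ..., 0, n - 1, ..., r + 1.  For 321, 132, 213 the cyclic order is
   reversed. *)
Definition cyclic_up_key (n : nat) (r v : 'I_n) : nat :=
  if (r <= v)%N then (v - r)%N else (v + n - r)%N.

Definition cyclic_down_key (n : nat) (r v : 'I_n) : nat :=
  if (v <= r)%N then (r - v)%N else (r + n - v)%N.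

Lemma num_avoiding_forests_key (n : nat) (key : 'I_n -> 'I_n -> nat)
    (patterns : seq (seq nat)) :
  all (fun s => size s == 3) patterns ->
  (forall r, injective (key r)) ->
  (forall r v, v != r -> key r r < key r v)%N ->
  (forall r u v : 'I_n, r != u -> r != v -> u != v ->
     ~~ has (same_relative_order [:: val r; val u; val v]) patterns ->
     key r u < key r v)%N ->
  (forall r a b c : 'I_n, (key r a < key r b < key r c)%N ->
     ~~ has (same_relative_order [:: val a; val b; val c]) patterns) ->
  num_avoiding_forests n patterns
  = (\sum_(k < n.+1) 'C(n, k) * \prod_(i < n - k) (k + i))%N.
Proof.
move=> size3 inj_key key_root key_lt sro_key.
(* The count by block sizes is the same for both keys, so it links the given key to the root-first
   one. *)
rewrite -card_root_first_increasing (@card_key_increasing _ (@root_first_key n)).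
- rewrite -(card_key_increasing inj_key key_root) /num_avoiding_forests -sum1dep_card.
  by apply: eq_bigl => p; apply: avoids_key_increasing.
- move=> r u v; rewrite /root_first_key.
  by case: eqP => [->|_]; case: eqP => [->|_] // [] /val_inj.
by move=> r v /negbTE vr; rewrite /root_first_key eqxx vr.
Qed.

Lemma num_avoiding_forests_up (n : nat) :
  num_avoiding_forests n [:: [:: 3; 2; 1]; [:: 1; 3; 2]; [:: 2; 1; 3]]%N
  = (\sum_(k < n.+1) 'C(n, k) * \prod_(i < n - k) (k + i))%N.
Proof.
apply: (@num_avoiding_forests_key n (@cyclic_up_key n)) => //.
- move=> r u v; rewrite /cyclic_up_key => uv; apply: val_inj => /=.
  (* As labels are below [n], every wrapped value [v + n - r] exceeds all unwrapped ones. *)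
  by move: uv (ltn_ord r) (ltn_ord u) (ltn_ord v); do 2!case: ifP; lia.
- move=> r v; rewrite /cyclic_up_key -val_eqE /=.
  by move: (ltn_ord r) (ltn_ord v); do 2!case: ifP; lia.
- move=> r u v; rewrite -!val_eqE /= !same_relative_order3 /= /cyclic_up_key.
  by move: (ltn_ord r) (ltn_ord u) (ltn_ord v); do 2!case: ifP; lia.
move=> r a b c; rewrite /= !same_relative_order3 /= /cyclic_up_key.
move: (ltn_ord r) (ltn_ord a) (ltn_ord b) (ltn_ord c).
by do 3!case: ifP; lia.
Qed.

Lemma num_avoiding_forests_down (n : nat) :
  num_avoiding_forests n [:: [:: 1; 2; 3]; [:: 3; 1; 2]; [:: 2; 3; 1]]%N
  = (\sum_(k < n.+1) 'C(n, k) * \prod_(i < n - k) (k + i))%N.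
Proof.
apply: (@num_avoiding_forests_key n (@cyclic_down_key n)) => //.
- move=> r u v; rewrite /cyclic_down_key => uv; apply: val_inj => /=.
  by move: uv (ltn_ord r) (ltn_ord u) (ltn_ord v); do 2!case: ifP; lia.
- move=> r v; rewrite /cyclic_down_key -val_eqE /=.
  by move: (ltn_ord r) (ltn_ord v); do 2!case: ifP; lia.
- move=> r u v; rewrite -!val_eqE /= !same_relative_order3 /= /cyclic_down_key.
  by move: (ltn_ord r) (ltn_ord u) (ltn_ord v); do 2!case: ifP; lia.
move=> r a b c; rewrite /= !same_relative_order3 /= /cyclic_down_key.
move: (ltn_ord r) (ltn_ord a) (ltn_ord b) (ltn_ord c).
by do 3!case: ifP; lia.
Qed.

Unset Implicit Arguments.

Theorem theorem5p8 (n : nat) (hn : (1 <= n)%N) :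
  num_avoiding_forests n [:: [:: 3; 2; 1]; [:: 1; 3; 2]; [:: 2; 1; 3]]%N
    = num_avoiding_forests n [:: [:: 1; 2; 3]; [:: 3; 1; 2]; [:: 2; 3; 1]]%N
  /\ (num_avoiding_forests n [:: [:: 1; 2; 3]; [:: 3; 1; 2]; [:: 2; 3; 1]]%N)%:R
       = (n`!)%:R * \sum_(1 <= k < n.+1) (k`!)%:R^-1 * ('C(n.-1, k.-1))%:R
       :> rat.
Proof.
rewrite num_avoiding_forests_up num_avoiding_forests_down; split=> //.
exact: root_count_sum.
Qed.
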